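(* Let $R$ be a commutative ring with unity, let $M$ be an $R$-module, let $N$ be a nonzero Noetherian $R$-module, and let $F$ be an $R$-submodule of $\operatorname{Hom}_R(N,M)$. For every $\mathfrak p\in\operatorname{Ass}_R(N)$, let $t(\mathfrak p)$ be a positive integer, and suppose that $t(\mathfrak p)\le\operatorname{inj}^{F_{\mathfrak p}}_{R_{\mathfrak p}}(M_{\mathfrak p},N_{\mathfrak p})$. For every multiplicatively closed subset $S$ of $R$ with $S\cap\operatorname{Ann}_R(N)=\varnothing$, define $u(S):=\min\{t(\mathfrak p):\mathfrak p\in\operatorname{Ass}_R(N),\ \mathfrak p\cap S=\varnothing\}$. Also let $v:=\max\{t(\mathfrak p):\mathfrak p\in\operatorname{Ass}_R(N)\}$. Then there exist $h_1,\dots,h_v\in F$ such that, for every multiplicatively closed subset $S$ of $R$ with $S\cap\operatorname{Ann}_R(N)=\varnothing$, the map $S^{-1}(h_1,\dots,h_{u(S)}):S^{-1}N^{\oplus u(S)}\to S^{-1}M$ is injective. Hence, letting $u:=u(\{1\})$, the map $(h_1,\dots,h_u):N^{\oplus u}\to M$ is injective.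
   Context: Multiplicatively closed subsets contain $1$. $\operatorname{Ann}_R(N)$ is the annihilator of $N$ in $R$. For a prime $\mathfrak p$ of $R$, $\operatorname{Soc}_{R_{\mathfrak p}}(N_{\mathfrak p})$ is the set of elements of $N_{\mathfrak p}$ annihilated by $\mathfrak p_{\mathfrak p}=\mathfrak pR_{\mathfrak p}$, and $\operatorname{Ass}_R(N)$ is the (finite) set of primes $\mathfrak p$ of $R$ with $\operatorname{Soc}_{R_{\mathfrak p}}(N_{\mathfrak p})\neq 0$. For an integer $t\ge 0$, $F^{\oplus t}\subseteq\operatorname{Hom}_R(N^{\oplus t},M)$ denotes the set of maps given by rows $(f_1,\dots,f_t)$, i.e. $(x_1,\dots,x_t)\mapsto\sum_j f_j(x_j)$, with all $f_j\in F$ (with $N^{\oplus 0}=0$). $\operatorname{inj}^F_R(M,N)$ (the global injective capacity of $M$ with respect to $N$ over $R$ when restricted to $F$) is the supremum of the integers $t\ge 0$ for which there is an injection in $F^{\oplus t}\subseteq\operatorname{Hom}_R(N^{\oplus t},M)$; it may be $\infty$. For a prime $\mathfrak p$, $F_{\mathfrak p}$ is the localization of $F$ at $\mathfrak p$, viewed inside $\operatorname{Hom}_{R_{\mathfrak p}}(N_{\mathfrak p},M_{\mathfrak p})$ by letting $f/s$ act as $\frac1s f_{\mathfrak p}$, and $\operatorname{inj}^{F_{\mathfrak p}}_{R_{\mathfrak p}}(M_{\mathfrak p},N_{\mathfrak p})$ is defined in the same way over $R_{\mathfrak p}$ with $F_{\mathfrak p}$ in place of $F$. *)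

(* Defs.v *)
From HB Require Import structures.
From mathcomp Require Import all_boot all_order all_algebra.
From mathcomp Require Import generic_quotient ring.
From mathcomp Require Import boolp classical_sets constructive_ereal.

Set Implicit Arguments.
Unset Strict Implicit.
Unset Printing Implicit Defensive.

Import Order.TTheory GRing.Theory Num.Theory.
Local Open Scope classical_set_scope.
Local Open Scope quotient_scope.
Local Open Scope ring_scope.

Definition submodule (R : pzRingType) (V : lmodType R) (A : set V) : Prop :=
  GRing.submod_closed [in A].

Definition lspan (R : pzRingType) (V : lmodType R) (n : nat) (g : 'I_n -> V)
    : set V :=
  [set \sum_(i < n) c i *: g i | c in @setT ('I_n -> R)].

Definition noetherian (R : pzRingType) (V : lmodType R) : Prop :=
  forall A : set V, submodule A -> exists n, exists g : 'I_n -> V, A = lspan g.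

Definition annihilator (R : pzRingType) (V : lmodType R) : set R :=
  [set a | forall x : V, a *: x = 0].

Definition linHom (R : comPzRingType) (U V : lmodType R) : Type :=
  {linear U -> V}.

Section HomModule.
Variables (R : comPzRingType) (U V : lmodType R).
Implicit Types f g h : linHom U V.

Lemma linHom_eqP f g : (f : U -> V) =1 g -> f = g.
Proof.
move=> /funext; case: f => f [[Df] [Zf]]; case: g => g [[Dg] [Zg]] /= efg.
by case: _ / efg in Dg Zg *; rewrite (Prop_irrelevance Df Dg)
  (Prop_irrelevance Zf Zg).
Qed.

HB.instance Definition _ := gen_eqMixin (linHom U V).
HB.instance Definition _ := gen_choiceMixin (linHom U V).

Definition hom_zero : linHom U V := (\0 : {linear U -> V}).
Definition hom_opp f : linHom U V := (\- f : {linear U -> V}).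
Definition hom_add f g : linHom U V := (f \+ g : {linear U -> V}).
Definition hom_scale (a : R) f : linHom U V := (a \*: f : {linear U -> V}).

Fact hom_addA : associative hom_add.
Proof. by move=> f g h; apply: linHom_eqP => x /=; rewrite addrA. Qed.
Fact hom_addC : commutative hom_add.
Proof. by move=> f g; apply: linHom_eqP => x /=; rewrite addrC. Qed.
Fact hom_add0 : left_id hom_zero hom_add.
Proof. by move=> f; apply: linHom_eqP => x /=; rewrite add0r. Qed.
Fact hom_addN : left_inverse hom_zero hom_opp hom_add.
Proof. by move=> f; apply: linHom_eqP => x /=; rewrite addNr. Qed.
HB.instance Definition _ :=
  GRing.isZmodule.Build (linHom U V) hom_addA hom_addC hom_add0 hom_addN.

Fact hom_scaleA a b f : hom_scale a (hom_scale b f) = hom_scale (a * b) f.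
Proof. by apply: linHom_eqP => x /=; rewrite scalerA. Qed.
Fact hom_scale1 : left_id 1 hom_scale.
Proof. by move=> f; apply: linHom_eqP => x /=; rewrite scale1r. Qed.
Fact hom_scaleDr : right_distributive hom_scale +%R.
Proof. by move=> a f g; apply: linHom_eqP => x /=; rewrite scalerDr. Qed.
Fact hom_scaleDl f : {morph hom_scale^~ f : a b / a + b}.
Proof. by move=> a b; apply: linHom_eqP => x /=; rewrite scalerDl. Qed.
HB.instance Definition _ := GRing.Zmodule_isLmodule.Build R (linHom U V)
  hom_scaleA hom_scale1 hom_scaleDr hom_scaleDl.

End HomModule.

Record mulset (R : comPzRingType) := Mulset {
  mulset_set :> set R;
  mulset1 : mulset_set 1;
  mulsetM : forall a b, mulset_set a -> mulset_set b -> mulset_set (a * b) }.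

Section Localization.
Variables (R : comPzRingType) (S : mulset R).

Record denom := Denom { den :> R; denomP : mulset_set S den }.
HB.instance Definition _ := gen_eqMixin denom.
HB.instance Definition _ := gen_choiceMixin denom.
Implicit Types s t : denom.

Definition denom1 : denom := Denom (mulset1 S).
Definition denomM s t : denom := Denom (mulsetM (denomP s) (denomP t)).

Section Module.
Variable V : lmodType R.

(* x/s = y/t iff w(tx - sy) = 0 for some w in S *)
Definition loc_rel (p q : V * denom) : bool :=
  `[< exists w : denom,
        den w *: (den q.2 *: p.1 - den p.2 *: q.1) = 0 >].

Lemma loc_relP (p q : V * denom) :
  reflect (exists w : denom,
             (den w * den q.2) *: p.1 = (den w * den p.2) *: q.1) (loc_rel p q).
Proof.
apply: (iffP (asboolP _)) => -[w].
  by move=> /eqP; rewrite scalerBr !scalerA subr_eq0 => /eqP; exists w.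
by move=> e; exists w; rewrite scalerBr !scalerA e subrr.
Qed.

Lemma loc_rel_refl : reflexive loc_rel.
Proof. by move=> p; apply/loc_relP; exists denom1. Qed.

Lemma loc_rel_sym : symmetric loc_rel.
Proof.
by move=> p q; apply/loc_relP/loc_relP => -[w e]; exists w; rewrite e.
Qed.

Lemma loc_rel_trans : transitive loc_rel.
Proof.
move=> q p r /loc_relP[w e] /loc_relP[w' e'].
apply/loc_relP; exists (denomM (denomM w w') q.2) => /=.
have -> : den w * den w' * den q.2 * den r.2
        = (den w' * den r.2) * (den w * den q.2) by ring.
rewrite -scalerA e scalerA.
have -> : den w' * den r.2 * (den w * den p.2)
        = (den w * den p.2) * (den w' * den r.2) by ring.
rewrite -scalerA e' scalerA; congr (_ *: _); ring.
Qed.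

Canonical loc_equiv := EquivRel loc_rel loc_rel_refl loc_rel_sym loc_rel_trans.

Definition loc : Type := {eq_quot loc_rel}.
HB.instance Definition _ : EqQuotient _ loc_rel loc := EqQuotient.on loc.
HB.instance Definition _ := Choice.on loc.

Definition lfrac (x : V) (s : denom) : loc := \pi_loc (x, s).

Lemma lfrac_eqP x s y t :
  lfrac x s = lfrac y t <->
  exists w : denom, (den w * den t) *: x = (den w * den s) *: y.
Proof.
by split=> [/eqP|e]; rewrite ?eqmodE; [move/loc_relP | apply/eqP; rewrite eqmodE; apply/loc_relP].
Qed.

Lemma lfrac_eq x s y t : den t *: x = den s *: y -> lfrac x s = lfrac y t.
Proof. by move=> e; apply/lfrac_eqP; exists denom1; rewrite !mul1r. Qed.

Lemma lfracK (z : loc) : lfrac (repr z).1 (repr z).2 = z.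
Proof. by rewrite /lfrac -surjective_pairing reprK. Qed.

Lemma loc_ind (P : loc -> Prop) : (forall x s, P (lfrac x s)) -> forall z, P z.
Proof. by move=> Pf z; rewrite -(lfracK z). Qed.

Lemma repr_lfracP x s : exists w : denom,
  (den w * den s) *: (repr (lfrac x s)).1
  = (den w * den (repr (lfrac x s)).2) *: x.
Proof. by apply/lfrac_eqP; rewrite lfracK. Qed.

Definition loc_zero : loc := lfrac 0 denom1.
Definition loc_opp (z : loc) : loc := lfrac (- (repr z).1) (repr z).2.
Definition loc_add (z z' : loc) : loc :=
  lfrac (den (repr z').2 *: (repr z).1 + den (repr z).2 *: (repr z').1)
       (denomM (repr z).2 (repr z').2).

Lemma loc_oppE x s : loc_opp (lfrac x s) = lfrac (- x) s.
Proof.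
rewrite /loc_opp; have [w] := repr_lfracP x s.
case: (repr _) => y t /= e; apply/lfrac_eqP; exists w.
by rewrite !scalerN e.
Qed.

Lemma loc_addE x s y t :
  loc_add (lfrac x s) (lfrac y t) =
  lfrac (den t *: x + den s *: y) (denomM s t).
Proof.
rewrite /loc_add; have [w] := repr_lfracP x s; have [w'] := repr_lfracP y t.
case: (repr (lfrac y t)) => y' t' /=; case: (repr (lfrac x s)) => x' s' /= e' e.
apply/lfrac_eqP; exists (denomM w w') => /=.
rewrite !scalerDr !scalerA; congr (_ + _).
  have -> : den w * den w' * (den s * den t) * den t'
    = (den w' * den t * den t') * (den w * den s) by ring.
  rewrite -scalerA e scalerA; congr (_ *: _); ring.
have -> : den w * den w' * (den s * den t) * den s'
  = (den w * den s * den s') * (den w' * den t) by ring.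
rewrite -scalerA e' scalerA; congr (_ *: _); ring.
Qed.

Fact loc_addA : associative loc_add.
Proof.
elim/loc_ind=> x s; elim/loc_ind=> y t; elim/loc_ind=> z u.
rewrite !loc_addE; apply: lfrac_eq => /=; rewrite !scalerDr !scalerA addrA.
by congr (_ *: _ + _ *: _ + _ *: _); ring.
Qed.
Fact loc_addC : commutative loc_add.
Proof.
elim/loc_ind=> x s; elim/loc_ind=> y t.
by rewrite !loc_addE addrC; apply: lfrac_eq => /=; rewrite mulrC.
Qed.
Fact loc_add0 : left_id loc_zero loc_add.
Proof.
elim/loc_ind=> x s; rewrite loc_addE; apply: lfrac_eq => /=.
by rewrite scaler0 add0r mul1r scale1r.
Qed.
Fact loc_addN : left_inverse loc_zero loc_opp loc_add.
Proof.
elim/loc_ind=> x s; rewrite loc_oppE loc_addE; apply: lfrac_eq => /=.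
by rewrite scalerN addNr !scaler0.
Qed.
HB.instance Definition _ :=
  GRing.isZmodule.Build loc loc_addA loc_addC loc_add0 loc_addN.

Lemma lfracD x s y t :
  lfrac x s + lfrac y t = lfrac (den t *: x + den s *: y) (denomM s t).
Proof. exact: loc_addE. Qed.
Lemma lfracN x s : - lfrac x s = lfrac (- x) s.
Proof. exact: loc_oppE. Qed.

End Module.

Definition locring : Type := loc R^o.
HB.instance Definition _ := GRing.Zmodule.on locring.

Definition rfrac (a : R) (s : denom) : locring := lfrac (a : R^o) s.

Section Scale.
Variable V : lmodType R.

Definition loc_scale (c : locring) (z : loc V) : loc V :=
  lfrac (((repr c).1 : R) *: (repr z).1) (denomM (repr c).2 (repr z).2).

Lemma loc_scaleE a s x t :
  loc_scale (rfrac a s) (lfrac x t) = lfrac (a *: x) (denomM s t).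
Proof.
rewrite /loc_scale; have [w] := repr_lfracP (a : R^o) s.
have [w'] := repr_lfracP x t; rewrite -/(rfrac a s).
case: (repr (lfrac x t)) => x' t' /=; case: (repr (rfrac a s)) => a' s' /= e' e.
have {}e : den w * den s * a' = den w * den s' * a := e.
apply/lfrac_eqP; exists (denomM w w') => /=; rewrite !scalerA.
have -> : den w * den w' * (den s * den t) * a'
  = (den w * den s * a') * (den w' * den t) by ring.
rewrite -scalerA e' scalerA e; congr (_ *: _); ring.
Qed.

End Scale.

Definition loc_one : locring := rfrac 1 denom1.
Definition loc_mul (c d : locring) : locring := loc_scale c (d : loc R^o).

Lemma loc_mulE a s b t :
  loc_mul (rfrac a s) (rfrac b t) = rfrac (a * b) (denomM s t).
Proof. exact: loc_scaleE. Qed.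

Lemma rfrac_eq a s b t :
  den t * a = den s * b -> rfrac a s = rfrac b t.
Proof. by move=> e; apply: lfrac_eq. Qed.

Lemma rfracD a s b t :
  rfrac a s + rfrac b t = rfrac (den t * a + den s * b) (denomM s t).
Proof. exact: lfracD. Qed.

Lemma locring_ind (P : locring -> Prop) :
  (forall a s, P (rfrac a s)) -> forall z, P z.
Proof. by move=> Pf; elim/loc_ind => x s; apply: Pf. Qed.

Fact loc_mulA : associative loc_mul.
Proof.
elim/locring_ind=> a s; elim/locring_ind=> b t; elim/locring_ind=> c u.
by rewrite !loc_mulE; apply: rfrac_eq => /=; ring.
Qed.
Fact loc_mulC : commutative loc_mul.
Proof.
elim/locring_ind=> a s; elim/locring_ind=> b t.
by rewrite !loc_mulE; apply: rfrac_eq => /=; ring.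
Qed.
Fact loc_mul1 : left_id loc_one loc_mul.
Proof.
by elim/locring_ind=> a s; rewrite loc_mulE; apply: rfrac_eq => /=; ring.
Qed.
Fact loc_mulDl : left_distributive loc_mul +%R.
Proof.
elim/locring_ind=> a s; elim/locring_ind=> b t; elim/locring_ind=> c u.
by rewrite rfracD !loc_mulE rfracD; apply: rfrac_eq => /=; ring.
Qed.
HB.instance Definition _ := GRing.Zmodule_isComPzRing.Build locring
  loc_mulA loc_mulC loc_mul1 loc_mulDl.

Section LocLmodule.
Variable V : lmodType R.

Fact loc_scaleA (c d : locring) (z : loc V) :
  loc_scale c (loc_scale d z) = loc_scale (c * d) z.
Proof.
elim/locring_ind: c => a s; elim/locring_ind: d => b t; elim/loc_ind: z => x u.
rewrite [_ * _]loc_mulE !loc_scaleE; apply: lfrac_eq => /=.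
by rewrite !scalerA; congr (_ *: _); ring.
Qed.
Fact loc_scale1 : left_id 1 (@loc_scale V).
Proof.
elim/loc_ind=> x u; rewrite loc_scaleE; apply: lfrac_eq => /=.
by rewrite mul1r scale1r.
Qed.
Fact loc_scaleDr : right_distributive (@loc_scale V) +%R.
Proof.
elim/locring_ind=> a s; elim/loc_ind=> x t; elim/loc_ind=> y u.
rewrite lfracD !loc_scaleE lfracD; apply: lfrac_eq => /=.
by rewrite !scalerDr !scalerA; congr (_ *: _ + _ *: _); ring.
Qed.
Fact loc_scaleDl (z : loc V) : {morph (@loc_scale V)^~ z : c d / c + d}.
Proof.
elim/loc_ind: z => x u; elim/locring_ind=> a s; elim/locring_ind=> b t.
rewrite rfracD !loc_scaleE lfracD; apply: lfrac_eq => /=.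
rewrite !scalerDr !scalerA -!scalerDl; congr (_ *: _); ring.
Qed.
HB.instance Definition _ := GRing.Zmodule_isLmodule.Build locring (loc V)
  loc_scaleA loc_scale1 loc_scaleDr loc_scaleDl.

Lemma lfracZ a s (x : V) t : rfrac a s *: lfrac x t = lfrac (a *: x) (denomM s t).
Proof. exact: loc_scaleE. Qed.

End LocLmodule.

Section LocMap.
Variables (U V : lmodType R) (f : linHom U V).

Definition loc_fun (z : loc U) : loc V := lfrac (f (repr z).1) (repr z).2.

Lemma loc_funE x s : loc_fun (lfrac x s) = lfrac (f x) s.
Proof.
rewrite /loc_fun; have [w] := repr_lfracP x s.
case: (repr _) => y t /= e; apply/lfrac_eqP; exists w.
by rewrite -!linearZ e.
Qed.

Fact loc_fun_linear : linear loc_fun.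
Proof.
elim/locring_ind=> a s; elim/loc_ind=> x t; elim/loc_ind=> y u.
rewrite lfracZ lfracD !loc_funE lfracZ lfracD.
by rewrite linearD; congr (lfrac (_ + _) _); rewrite linearZ /= ?linearZ.
Qed.
HB.instance Definition _ :=
  GRing.isLinear.Build locring (loc U) (loc V) *:%R loc_fun loc_fun_linear.

Definition loc_map : linHom (loc U) (loc V) := (loc_fun : {linear loc U -> loc V}).

Lemma loc_mapE x s : loc_map (lfrac x s) = lfrac (f x) s.
Proof. exact: loc_funE. Qed.

End LocMap.

(* The localization of F, viewed inside Hom(S^-1 U, S^-1 V): the fraction f/s
   acts as (1/s) S^-1 f *)
Definition loc_hom (U V : lmodType R) (F : set (linHom U V))
    : set (linHom (loc U) (loc V)) :=
  [set g | exists f, exists s : denom, F f /\ g = rfrac 1 s *: loc_map f].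

End Localization.

Arguments lfrac {R} S {V} x s.
Arguments rfrac {R} S a s.
Arguments loc_map {R} S {U V} f.
Arguments loc_hom {R} S {U V} F.

Definition mulset_one (R : comPzRingType) : mulset R.
Proof. by exists [set 1] => // a b -> ->; rewrite mulr1. Defined.

Record prime_ideal (R : comPzRingType) := PrimeIdeal {
  prime_set :> set R;
  prime_submod : submodule (prime_set : set R^o);
  prime_proper : ~ prime_set 1;
  prime_or : forall a b, prime_set (a * b) -> prime_set a \/ prime_set b }.

Definition prime_compl (R : comPzRingType) (p : prime_ideal R) : mulset R.
Proof.
exists (~` p); first exact: prime_proper.
by move=> a b pa pb /prime_or[].
Defined.

Definition loc_ideal (R : comPzRingType) (p : prime_ideal R)
    : set (locring (prime_compl p)) :=
  [set c | exists a, exists s, prime_set p a /\ c = rfrac (prime_compl p) a s].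

Definition Soc (R : comPzRingType) (p : prime_ideal R) (N : lmodType R)
    : set (loc (prime_compl p) N) :=
  [set z | forall c, loc_ideal c -> c *: z = 0].
Arguments Soc {R} p N.

Definition Ass (R : comPzRingType) (N : lmodType R) : set (prime_ideal R) :=
  [set p | Soc p N <> [set 0]].

Section Row.
Variables (R : comPzRingType) (N M : lmodType R) (t : nat).

Definition row_fun (f : 'I_t -> linHom N M) (x : {ffun 'I_t -> N}) : M :=
  \sum_(j < t) f j (x j).

Fact row_fun_linear f : linear (row_fun f).
Proof.
move=> a x y; rewrite /row_fun scaler_sumr -big_split /=.
by apply: eq_bigr => j _; rewrite !ffunE linearP.
Qed.
HB.instance Definition _ f :=
  GRing.isLinear.Build R {ffun 'I_t -> N} M *:%R (row_fun f) (row_fun_linear f).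

Definition row_hom (f : 'I_t -> linHom N M) : linHom {ffun 'I_t -> N} M :=
  (row_fun f : {linear {ffun 'I_t -> N} -> M}).

Definition hom_rows (F : set (linHom N M)) : set (linHom {ffun 'I_t -> N} M) :=
  [set g | exists f, (forall j, F (f j)) /\ g = row_hom f].

End Row.

(* [\bar int] serves as the integers with infinities, in which every nonempty
   set of natural numbers has a supremum (+oo if it is unbounded). *)
Definition inj_capacity (R : comPzRingType) (N M : lmodType R)
    (F : set (linHom N M)) : \bar int :=
  supremum 0%E
    [set t%:Z%:E | t in
      [set t : nat | exists g : linHom {ffun 'I_t -> N} M,
                       hom_rows F g /\ injective g]].

(* 0 is a dummy value for when there is no minimum, resp. maximum. *)
Definition nat_min (A : set nat) : nat := xget 0%N (A `&` lbound A).
Definition nat_max (A : set nat) : nat := xget 0%N (A `&` ubound A).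

Lemma nat_minP (A : set nat) : A !=set0 -> (A `&` lbound A) (nat_min A).
Proof.
move=> [n An]; apply: (@xgetPex _ 0%N (A `&` lbound A)).
have [|m /asboolP Am mP] := ex_minnP (P := fun k => `[< A k >]).
  by exists n; apply/asboolP.
by exists m; split=> // k Ak; apply/mP/asboolP.
Qed.

Lemma nat_maxP (A : set nat) (b : nat) :
  A !=set0 -> ubound A b -> (A `&` ubound A) (nat_max A).
Proof.
move=> [n An] Ab; apply: (@xgetPex _ 0%N (A `&` ubound A)).
have [||m /asboolP Am mP] := ex_maxnP (P := fun k => `[< A k >]) (m := b).
- by exists n; apply/asboolP.
- by move=> k /asboolP/Ab.
by exists m; split=> // k Ak; apply/mP/asboolP.
Qed.

Section Bounds.
Variables (R : comPzRingType) (N : lmodType R) (t : prime_ideal R -> nat).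

Definition ass_min (S : mulset R) : nat :=
  nat_min [set t p | p in [set p | Ass N p /\ p `&` S = set0]].

Definition ass_max : nat := nat_max [set t p | p in Ass N].

End Bounds.

(* Main.v *)
(* A nonzero kernel of [S^-1 (h_1, ..., h_u)] would contain, N^u being
   Noetherian, an element whose annihilator is a prime p in Ass(N) disjoint from
   S. So it suffices that, for each of the finitely many p in Ass(N), the row
   (h_1, ..., h_t(p)) is injective on Soc(N_p)^t(p). Such rows are built one
   prime at a time, never passing from a prime to a larger one: given h that
   works for the previous primes and a row f that works for p, choose a outside
   p and inside all previous primes, and add to h a suitable multiple of a,
   which leaves the previous socles untouched. If R/p is a field this can turn h
   into f on the socle at p; otherwise R/p is infinite and some h + lambda f
   with lambda in a R works, because the bad values of - lambda are eigenvalues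
   of h relative to f on a finite-dimensional space. *)
From HB Require Import structures.
Require Import Defs.
From mathcomp Require Import all_boot all_order all_algebra.
From mathcomp Require Import ring.
From mathcomp Require Import boolp classical_sets constructive_ereal.

Set Implicit Arguments.
Unset Strict Implicit.
Unset Printing Implicit Defensive.

Import Order.TTheory GRing.Theory Num.Theory.
Local Open Scope classical_set_scope.
Local Open Scope ring_scope.

(** * Submodules and the ascending chain condition *)

Section Submodules.
Variables (R : comPzRingType) (V : lmodType R).
Implicit Types (A : set V) (x y : V) (a b : R).

Lemma submoduleE A :
  submodule A <-> A 0 /\ forall a x y, A x -> A y -> A (a *: x + y).
Proof.
split=> -[A0 AL]; split; rewrite ?in_setE // in A0 *.
  by move=> a x y Ax Ay; have := AL a x y; rewrite !in_setE; apply.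
by move=> a x y; rewrite !in_setE => Ax Ay; apply: AL.
Qed.

Lemma submodule0 A : submodule A -> A 0.
Proof. by case/submoduleE. Qed.

Lemma submoduleD A x y : submodule A -> A x -> A y -> A (x + y).
Proof. by case/submoduleE=> _ AL Ax Ay; have := AL 1 _ _ Ax Ay; rewrite scale1r. Qed.

Lemma submoduleZ A a x : submodule A -> A x -> A (a *: x).
Proof. by case/submoduleE=> A0 AL Ax; have := AL a _ _ Ax A0; rewrite addr0. Qed.

Lemma submoduleB A x y : submodule A -> A x -> A y -> A (x - y).
Proof. by move=> sA Ax Ay; rewrite -scaleN1r; do 2?[apply: submoduleD|apply: submoduleZ]. Qed.

Lemma submodule_sum A (I : Type) (r : seq I) (P : pred I) (f : I -> V) :
  submodule A -> (forall i, P i -> A (f i)) -> A (\sum_(i <- r | P i) f i).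
Proof.
move=> sA Af; elim/big_rec: _ => [|i x Pi Ax]; first exact: submodule0.
by apply: submoduleD => //; apply: Af.
Qed.

Lemma lspanP n (g : 'I_n -> V) : submodule (lspan g).
Proof.
apply/submoduleE; split.
  by exists (fun=> 0) => //; rewrite big1 // => i _; rewrite scale0r.
move=> a _ _ [c _ <-] [d _ <-]; exists (fun i => a * c i + d i) => //.
rewrite scaler_sumr -big_split /=; apply: eq_bigr => i _.
by rewrite scalerDl scalerA.
Qed.

Lemma lspan_gen n (g : 'I_n -> V) i : lspan g (g i).
Proof.
exists (fun j => (j == i)%:R) => //; rewrite (bigD1 i) //= eqxx scale1r.
by rewrite big1 ?addr0 // => j /negPf ->; rewrite scale0r.
Qed.

Lemma chain_le (A : nat -> set V) :
  (forall n, A n `<=` A n.+1) -> forall m n, (m <= n)%N -> A m `<=` A n.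
Proof.
move=> AS m; elim=> [|n IH]; first by rewrite leqn0 => /eqP->.
by rewrite leq_eqVlt => /predU1P[->//|/IH mn] x /mn/AS.
Qed.

(** The condition is relative to a subset D so that it applies to kernels and other parts of V
    without turning them into modules of their own. *)
Definition acc_in (D : set V) := forall A : nat -> set V,
  (forall n, submodule (A n)) -> (forall n, A n `<=` A n.+1) ->
  (forall n, A n `<=` D) -> exists n, forall m, A m `<=` A n.

Lemma noetherian_acc : noetherian V -> acc_in setT.
Proof.
move=> VN A sA AS _; pose U := [set x | exists n, A n x].
have sU : submodule U.
  apply/submoduleE; split; first by exists 0%N; apply: submodule0.
  move=> a x y [m Ax] [n Ay]; exists (maxn m n).
  have le := chain_le AS; apply: submoduleD => //; last exact: le (leq_maxr _ _) _ Ay.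
  by apply: submoduleZ => //; apply: le (leq_maxl _ _) _ Ax.
have [n [g Ug]] := VN _ sU.
have /choice[k Ak] i : exists k, A k (g i).
  by have : U (g i) by rewrite Ug; apply: lspan_gen.
exists (\max_i k i) => m x Ax; have : U x by exists m.
rewrite Ug => -[c _ <-]; apply: submodule_sum => // i _; apply: submoduleZ => //.
by apply: (chain_le AS) (Ak i); apply: leq_bigmax.
Qed.

(** Without a maximal member, dependent choice would build a strictly ascending chain. *)
Lemma acc_max (C : set (set V)) : acc_in setT ->
  (forall A, C A -> submodule A) -> C !=set0 ->
  exists2 A, C A & forall B, C B -> A `<=` B -> B `<=` A.
Proof.
move=> VN sC [A0 CA0]; apply: contrapT => nmax.
pose T := {A | C A}.
have next (A : T) : {B : T | sval A `<=` sval B /\ ~ (sval B `<=` sval A)}.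
  apply: cid; case: A => A CA /=; apply: contrapT => nB; apply: nmax.
  exists A => // B CB AB; apply: contrapT => BA; apply: nB.
  by exists (exist _ B CB).
have [f [_ fS]] := dependent_choice next (exist _ A0 CA0).
have [||//|n fn] := VN (fun n => sval (f n)).
- by move=> n; apply/sC/(svalP (f n)).
- by move=> n; apply (fS n).
by have [_] := fS n; apply.
Qed.

Lemma submoduleI A B : submodule A -> submodule B -> submodule (A `&` B).
Proof.
move=> /submoduleE[A0 AL] /submoduleE[B0 BL]; apply/submoduleE.
by split=> // a x y [? ?] [? ?]; split; [apply: AL | apply: BL].
Qed.

End Submodules.

(** * The chain condition for extensions and finite powers *)

Section Extension.
Variables (R : comPzRingType) (V W : lmodType R) (f : {linear V -> W}).

Lemma submodule_ker : submodule [set x | f x = 0].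
Proof.
apply/submoduleE; split=> [|a x y /= fx fy]; first by rewrite /= linear0.
by rewrite linearP fx fy scaler0 addr0.
Qed.

Lemma submodule_image (A : set V) : submodule A -> submodule (f @` A).
Proof.
move=> sA; apply/submoduleE; split.
  by exists 0; [apply: submodule0 | rewrite linear0].
move=> a _ _ [x Ax <-] [y Ay <-]; exists (a *: x + y); last by rewrite linearP.
by apply: submoduleD => //; apply: submoduleZ.
Qed.

(** The chain is stable once its images in W and its intersections with the kernel are: an x from a
    later stage differs by a kernel element from some y in the stable stage. *)
Lemma acc_ext (D : set V) :
  acc_in (V := W) setT -> acc_in (D `&` [set x | f x = 0]) -> acc_in D.
Proof.
move=> accW accK A sA AS AD.
have [||//|n1 n1P] := accW (fun n => f @` A n).
- by move=> n; apply: submodule_image.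
- by move=> n _ [x Ax <-]; exists x => //; apply: AS.
have [||n x [Ax fx]|n2 n2P] := accK (fun n => A n `&` [set x | f x = 0]).
- by move=> n; apply: submoduleI => //; apply: submodule_ker.
- by move=> n x [Ax fx]; split => //; apply: AS.
- by split=> //; apply: AD Ax.
have le := chain_le AS; exists (maxn n1 n2) => m x Ax.
have [|y Ay yx] := n1P m (f x); first by exists x.
have Ay' := le _ _ (leq_maxl n1 n2) _ Ay.
rewrite -[x](subrK y); apply: submoduleD => //; apply: (le _ _ (leq_maxr n1 n2)).
have [|//] := n2P (maxn m n1) (x - y); split; last by rewrite /= linearB yx subrr.
by apply: submoduleB => //; apply: le; [exact: leq_maxl| |exact: leq_maxr|].
Qed.

End Extension.

Section FfunAcc.
Variables (R : comPzRingType) (N : lmodType R) (n : nat).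

Definition coord (i : 'I_n) (x : {ffun 'I_n -> N}) : N := x i.
Fact coord_linear i : linear (coord i).
Proof. by move=> a x y; rewrite /coord !ffunE. Qed.
HB.instance Definition _ i :=
  GRing.isLinear.Build R {ffun 'I_n -> N} N *:%R (coord i) (coord_linear i).

Lemma acc_ffun : acc_in (V := N) setT -> acc_in (V := {ffun 'I_n -> N}) setT.
Proof.
move=> accN.
(* Induction on the number k of coordinates allowed to be nonzero; the kernel of coordinate k on the
   next stage is the current stage. *)
suff H k : (k <= n)%N -> acc_in [set x : {ffun 'I_n -> N} |
    forall i : 'I_n, (k <= i)%N -> x i = 0].
  have := H n (leqnn n); congr (acc_in _); apply/seteqP; split=> // x _ i.
  by rewrite leqNgt ltn_ord.
elim: k => [_ A sA AS AD|k IH kn].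
  exists 0%N => m x /AD x0; suff -> : x = 0 by apply: submodule0.
  by apply/ffunP => i; rewrite x0 // ffunE.
apply: (acc_ext (f := coord (Ordinal kn))) => //.
move=> A sA AS AD; apply: IH => //; first exact: ltnW.
move=> m x /AD[x1 x0] i; rewrite leq_eqVlt => /predU1P[ki|]; last exact: x1.
by rewrite -x0; congr (x _); apply: val_inj.
Qed.

End FfunAcc.

(** * Torsion elements and prime annihilators *)

Section Torsion.
Variables (R : comPzRingType).
Implicit Types (S : mulset R) (p q : prime_ideal R).

(** The elements that become zero in the localization at S; they allow localized statements to be
    treated without fractions. *)
Definition torsion S (V : lmodType R) (x : V) := exists2 s, mulset_set S s & s *: x = 0.

Lemma torsionZ S (V : lmodType R) a (x : V) : torsion S x -> torsion S (a *: x).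
Proof. by case=> s Ss sx; exists s => //; rewrite scalerA mulrC -scalerA sx scaler0. Qed.

Lemma torsionD S (V : lmodType R) (x y : V) :
  torsion S x -> torsion S y -> torsion S (x + y).
Proof.
case=> s Ss sx [r Sr ry]; exists (s * r); first exact: mulsetM.
by rewrite scalerDr -[_ *: y]scalerA ry scaler0 mulrC -scalerA sx scaler0 addr0.
Qed.

Lemma torsion_divl S (V : lmodType R) a (x : V) :
  mulset_set S a -> torsion S (a *: x) -> torsion S x.
Proof. by move=> Sa [s Ss sx]; exists (s * a); [apply: mulsetM | rewrite -scalerA]. Qed.

Lemma common_torsion S (V : lmodType R) (n : nat) (x : 'I_n -> V) :
  (forall i, torsion S (x i)) -> exists2 s, mulset_set S s & forall i, s *: x i = 0.
Proof.
move=> tx; have /choice[s sP] i : exists s, mulset_set S s /\ s *: x i = 0.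
  by case: (tx i) => s Ss sx; exists s.
exists (\prod_i s i).
  elim/big_rec: _ => [|i a _ Sa]; first exact: mulset1.
  by apply: mulsetM => //; case: (sP i).
move=> i; rewrite (bigD1 i) //= mulrC -scalerA; case: (sP i) => _ ->.
exact: scaler0.
Qed.

Lemma torsion_ffun S (V : lmodType R) n (x : {ffun 'I_n -> V}) :
  torsion S x <-> forall i, torsion S (x i).
Proof.
split=> [[s Ss sx] i|/common_torsion[s Ss sx]].
  by exists s => //; move/ffunP/(_ i): sx; rewrite !ffunE.
by exists s => //; apply/ffunP => i; rewrite !ffunE sx.
Qed.

Lemma prime_ideal_eq p q : (forall a, prime_set p a <-> prime_set q a) -> p = q.
Proof.
move=> pq; have {}pq : prime_set p = prime_set q by apply/seteqP; split=> a /pq.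
case: p q pq => p p1 p2 p3 [q q1 q2 q3] /= pq; case: _ / pq in q1 q2 q3 *.
by congr PrimeIdeal; apply: Prop_irrelevance.
Qed.

Lemma prime_idealD p a b : prime_set p a -> prime_set p b -> prime_set p (a + b).
Proof. exact: (submoduleD (@prime_submod _ p)). Qed.
Lemma prime_idealMl p a b : prime_set p b -> prime_set p (a * b).
Proof. exact: (submoduleZ a (@prime_submod _ p)). Qed.
Lemma prime_idealMr p a b : prime_set p a -> prime_set p (a * b).
Proof. by rewrite mulrC; apply: prime_idealMl. Qed.

Definition annih (V : lmodType R) (x : V) : set R := [set a | a *: x = 0].

Lemma annih_submod (V : lmodType R) (x : V) : submodule (annih x : set R^o).
Proof.
apply/submoduleE; split=> [|a b c]; rewrite /annih /= ?scale0r // => bx cx.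
by rewrite scalerDl cx addr0 -[a *: b]/(a * b) -scalerA bx scaler0.
Qed.

(** Among the annihilators of non-torsion multiples of x, a maximal one is prime. The chain
    condition holds in V and not in R, so the ideals Ann(r x) are compared through the submodules
    Ann(r x) x, which determine them because each ideal contains Ann(x). *)
Lemma exists_prime_annih (V : lmodType R) S (x : V) : acc_in (V := V) setT ->
  ~ torsion S x ->
  exists p r, [/\ annih (r *: x) = p, p `&` S = set0 & ~ torsion S (r *: x)].
Proof.
move=> accV tx.
pose I r := [set a *: x | a in annih (r *: x)].
have sI r : submodule (I r).
  apply/submoduleE; split.
    by exists 0; rewrite ?scale0r //; apply: (submodule0 (annih_submod _)).
  move=> a _ _ [b bP <-] [c cP <-]; exists (a * b + c).
    apply: (submoduleD (annih_submod _)) => //.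
    exact: (submoduleZ a (annih_submod _) bP).
  by rewrite scalerDl scalerA.
pose C := [set I r | r in [set r | ~ torsion S (r *: x)]].
have [||_ [r tr <-] rmax] := @acc_max _ _ C accV.
- by move=> _ [r _ <-].
- by exists (I 1); exists 1; rewrite //= scale1r.
(* Maximality in usable form: multiplying r x by a, if the result is not torsion, does not enlarge
   the annihilator. *)
have {}rmax a b : ~ torsion S (a *: (r *: x)) -> b *: (a *: (r *: x)) = 0 ->
    b *: (r *: x) = 0.
  rewrite !scalerA => ta bar.
  have [|_ [c cr <-]||c cr cb] := rmax (I (a * r)) _ _ (b *: x).
  - by exists (a * r).
  - exists c => //; move: cr; rewrite /annih /= !scalerA => cr.
    by rewrite mulrCA -scalerA cr scaler0.
  - by exists b => //; rewrite /annih /= scalerA.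
  by rewrite mulrC -scalerA -cb scalerA mulrC -scalerA.
have SP s : mulset_set S s -> ~ torsion S (s *: (r *: x)).
  by move=> Ss ts; apply: tr; apply: torsion_divl ts.
have p1 : ~ annih (r *: x) 1.
  by rewrite /annih /= scale1r => r0; apply: tr; exists 1; rewrite ?scale1r //; apply: mulset1.
(* If some s in S kills a r x, then a kills s r x, and maximality applied to s gives a r x = 0;
   otherwise maximality applies to a itself. *)
have por a b : annih (r *: x) (a * b) -> annih (r *: x) a \/ annih (r *: x) b.
  rewrite /annih /= => abx; have [ta|ta] := pselect (torsion S (a *: (r *: x))).
    left; case: ta => s Ss sax; apply: (rmax s); first exact: SP.
    by rewrite scalerA mulrC -scalerA.
  by right; apply: (rmax a) => //; rewrite scalerA mulrC.
exists (PrimeIdeal (annih_submod _) p1 por), r; split=> //.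
apply/seteqP; split=> // s [/= sx Ss]; apply: tr; exists s => //.
Qed.

End Torsion.

HB.instance Definition _ (R : comPzRingType) := gen_eqMixin (prime_ideal R).

(** * Associated primes and their finiteness *)

Section AssociatedPrimes.
Variables (R : comPzRingType) (N : lmodType R).
Implicit Types (S : mulset R) (p q : prime_ideal R).

Lemma lfrac_eq0 S (x : N) s : lfrac S x s = 0 <-> torsion S x.
Proof.
rewrite -[0]/(lfrac S 0 (denom1 S)) lfrac_eqP.
split=> [[w]|[w Sw wx]].
  by rewrite scaler0 /= mulr1 => wx; exists (den w) => //; apply: denomP.
by exists (Denom Sw); rewrite scaler0 /= mulr1.
Qed.

Definition killed_by p : set N := [set x | forall a, prime_set p a -> a *: x = 0].

Lemma killed_byZ p a x : killed_by p x -> killed_by p (a *: x).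
Proof. by move=> px b pb; rewrite scalerA mulrC -scalerA px ?scaler0. Qed.

Lemma AssE p :
  Ass N p <-> exists2 z, Soc p N z & z <> 0.
Proof.
split=> [Sp|[z Sz z0] S0]; last by apply: z0; rewrite S0 in Sz.
apply: contrapT => nz; apply: Sp; apply/seteqP; split=> [z Sz|_ ->].
  by apply: contrapT => z0; apply: nz; exists z.
by move=> c _; rewrite scaler0.
Qed.

Lemma killed_by_Ass p x : killed_by p x -> ~ torsion (prime_compl p) x -> Ass N p.
Proof.
move=> px tx; apply/AssE; exists (lfrac _ x (denom1 _)); last by move/lfrac_eq0.
move=> _ [a [s [pa ->]]]; rewrite lfracZ px //; apply/lfrac_eq0.
by exists 1; rewrite ?scaler0 //; apply: mulset1.
Qed.

(** For a nonzero socle element x/s, the submodule p x is finitely generated because N is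
    Noetherian, and it vanishes in the localization at p. A single w outside p therefore kills it,
    and Ann(w x) = p. *)
Lemma Ass_annih p : noetherian N -> Ass N p -> exists x : N, annih x = prime_set p.
Proof.
move=> NN /AssE[z]; elim/loc_ind: z => x s Sx x0.
have {x0} tx : ~ torsion (prime_compl p) x by move/lfrac_eq0.
have sP : submodule [set a *: x | a in prime_set p].
  apply/submoduleE; split.
    by exists 0; rewrite ?scale0r //; apply: (submodule0 (@prime_submod _ p)).
  move=> b _ _ [a pa <-] [c pc <-]; exists (b * a + c).
    by apply: prime_idealD => //; apply: prime_idealMl.
  by rewrite scalerDl scalerA.
have [n [g pxE]] := NN _ sP.
have [i|w pw wg] := common_torsion (S := prime_compl p) (x := g).
  have [a pa <-] : [set a *: x | a in prime_set p] (g i).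
    by rewrite pxE; apply: lspan_gen.
  have /Sx : loc_ideal (rfrac (prime_compl p) a s) by exists a, s.
  by rewrite lfracZ => /lfrac_eq0.
exists (w *: x); apply/seteqP; split=> [b bwx|b pb].
  apply: contrapT => pb; apply: tx; exists (b * w).
    by apply: (mulsetM (m := prime_compl p)).
  by rewrite -scalerA.
have : [set a *: x | a in prime_set p] (b *: x) by exists b.
rewrite pxE => -[c _ bx]; rewrite /annih /= scalerA mulrC -scalerA -bx.
rewrite scaler_sumr big1 // => i _.
by rewrite scalerA mulrC -scalerA wg scaler0.
Qed.

(* [p] is an associated prime of N/A. *)
Definition quot_ass (A : set N) p := exists x, prime_set p = [set a | A (a *: x)].

(* Ass(N/A) is contained in Ass(B/A) and Ass(N/B), where B/A = R/q. *)
Lemma quot_ass_extend A x q p :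
  submodule A -> prime_set q = [set a | A (a *: x)] ->
  quot_ass A p -> p <> q -> quot_ass [set y | exists c, A (y - c *: x)] p.
Proof.
move=> sA qE [y pE] pq; exists y; rewrite pE; apply/seteqP; split=> [r Ary|r].
  by exists 0; rewrite scale0r subr0.
(* If r y and c x agree modulo A and r y is not in A, then r is outside p and c outside q, so the
   annihilators of these two elements modulo A are p and q, whence p = q. *)
move=> /= [c Arc]; apply: contrapT => nAry; apply: pq; apply: prime_ideal_eq => a.
have AE b : A (b *: (r *: y)) <-> A (b *: (c *: x)).
  have Ab : A (b *: (r *: y) - b *: (c *: x)) by rewrite -scalerBr; apply: submoduleZ.
  split=> Abr.
    by rewrite -[_ *: _](subKr (b *: (r *: y))); apply: submoduleB.
  by rewrite -[_ *: _](subrK (b *: (c *: x))); apply: submoduleD.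
have pr : ~ prime_set p r by rewrite pE.
have qc : ~ prime_set q c.
  by rewrite qE => Acx; apply: nAry; have := AE 1; rewrite !scale1r => -[_]; apply.
have := AE a; rewrite !scalerA => {}AE.
have <- : prime_set p (a * r) <-> prime_set p a.
  by split=> [/prime_or[]//|]; apply: prime_idealMr.
have <- : prime_set q (a * c) <-> prime_set q a.
  by split=> [/prime_or[]//|]; apply: prime_idealMr.
by rewrite pE qE.
Qed.

(** Noetherian induction: let A be maximal among the submodules for which N/A has infinitely many
    associated primes. Enlarging A to B = A + R x with B/A = R/q loses at most the prime q, and N/B
    has only finitely many. *)
Lemma finite_Ass : noetherian N ->
  exists l : seq (prime_ideal R), forall p, Ass N p -> p \in l.
Proof.
move=> NN; pose C := [set A : set N | submodule A /\
  ~ exists l : seq (prime_ideal R), forall p, quot_ass A p -> p \in l].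
have C0 : C = set0.
  apply/eqP/negPn/negP => /set0P Cn0.
  have [A [sA nA] maxA] := acc_max (noetherian_acc NN) (fun A => @proj1 _ _) Cn0.
  have [[q [x qE]]|nq] := pselect (exists q, quot_ass A q); last first.
    by apply: nA; exists [::] => p Ap; case: nq; exists p.
  pose B := [set y | exists c, A (y - c *: x)].
  have AB : A `<=` B by move=> y Ay; exists 0; rewrite scale0r subr0.
  have sB : submodule B.
    apply/submoduleE; split; first by apply: AB; apply: submodule0.
    move=> a y z [c Ac] [d Ad]; exists (a * c + d).
    have -> : a *: y + z - (a * c + d) *: x = a *: (y - c *: x) + (z - d *: x).
      by rewrite scalerDl opprD addrACA scalerBr scalerA.
    by apply: submoduleD => //; apply: submoduleZ.
  have [l lP] : exists l : seq (prime_ideal R), forall p, quot_ass B p -> p \in l.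
    apply: contrapT => nB; have /(_ x) : B `<=` A by apply: maxA.
    move=> BA; apply: (@prime_proper _ q); rewrite qE /= scale1r; apply: BA.
    by exists 1; rewrite scale1r subrr; apply: submodule0.
  apply: nA; exists (q :: l) => p Ap; rewrite in_cons.
  have [->//|pq] := eqVneq p q.
  by apply: lP; apply: quot_ass_extend qE Ap _ => //; apply/eqP.
have [l lP] : exists l : seq (prime_ideal R), forall p, quot_ass [set 0] p -> p \in l.
  apply: contrapT => nl; have : C [set 0]; last by rewrite C0.
  split=> //; apply/submoduleE; split=> // a x y -> ->.
  by rewrite /= scaler0 addr0.
exists l => p /(Ass_annih NN)[x xE]; apply: lP; exists x.
by rewrite -xE.
Qed.

End AssociatedPrimes.

Lemma torsion_map (R : comPzRingType) (S : mulset R) (V M : lmodType R)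
    (f : {linear V -> M}) x : torsion S x -> torsion S (f x).
Proof. by case=> s Ss sx; exists s => //; rewrite -linearZ sx linear0. Qed.

(** * Perturbing a map to be injective on the socle at one prime *)

Section Pencil.
Variables (R : comPzRingType) (V M : lmodType R) (p : prime_ideal R).
Implicit Types (f h : linHom V M) (x : V).
Local Notation tors := (torsion (prime_compl p)).

(* Injectivity on Soc(V_p), with denominators cleared. *)
Definition soc_inj f := forall x, killed_by p x -> tors (f x) -> tors x.

Lemma killed_by_sum (w : nat -> V) (c : nat -> R) n :
  (forall i, killed_by p (w i)) -> killed_by p (\sum_(i < n) c i *: w i).
Proof.
move=> wp a pa; rewrite scaler_sumr big1 // => i _.
exact: (killed_byZ _ (wp i)).
Qed.

(* The [w i] are eigenvectors of h against f for distinct eigenvalues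
   [- lam i], hence independent over the residue field of p. *)
Lemma eigen_free f h (lam : nat -> R) (w : nat -> V) :
  soc_inj f -> (forall m n, (m < n)%N -> ~ prime_set p (lam m - lam n)) ->
  (forall n, killed_by p (w n)) -> (forall n, ~ tors (w n)) ->
  (forall n, h (w n) = - lam n *: f (w n)) ->
  forall n (c : nat -> R), tors (\sum_(i < n) c i *: w i) ->
    forall i, (i < n)%N -> prime_set p (c i).
Proof.
move=> finj lamP wp wtors hw; elim=> // n IH c cw.
(* Applying h to the relation and cancelling f gives a second relation, weighted by the [lam i];
   subtracting [lam n] times the first eliminates [w n]. *)
have cw' : tors (\sum_(i < n.+1) (c i * lam i) *: w i).
  apply: finj; first exact: (killed_by_sum (fun i => c i * lam i)).
  have <- : h (- \sum_(i < n.+1) c i *: w i) = f (\sum_(i < n.+1) (c i * lam i) *: w i).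
    rewrite -sumrN !linear_sum; apply: eq_bigr => i _ /=.
    by rewrite linearN !linearZ /= hw scaleNr !scalerN opprK scalerA.
  by apply: torsion_map; rewrite -scaleN1r; apply: torsionZ.
have c_lt i : (i < n)%N -> prime_set p (c i).
  move=> ltin; have [] // := @prime_or _ p (c i) (lam i - lam n); last first.
    by move/lamP; case.
  apply: (IH (fun i => c i * (lam i - lam n))) ltin.
  have := torsionD cw' (torsionZ (- lam n) cw); congr (tors _).
  rewrite !big_ord_recr /= scalerDr addrACA !scalerA mulNr [lam n * _]mulrC.
  rewrite -scalerDl subrr scale0r addr0 scaler_sumr -big_split /=.
  by apply: eq_bigr => j _; rewrite scalerA -scalerDl; congr (_ *: _); ring.
move=> i; rewrite ltnS leq_eqVlt => /predU1P[->|]; last exact: c_lt.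
apply: contrapT => pcn; apply: (wtors n); apply: (torsion_divl (S := prime_compl p) pcn).
move: cw; rewrite big_ord_recr /= big1 ?add0r // => j _.
exact/wp/c_lt.
Qed.

(** If every [lam n] failed, each would provide an eigenvector [w n]. The spans of the first n of
    these form an ascending chain, whose stabilization contradicts their independence. *)
Lemma soc_inj_pencil f h (lam : nat -> R) : acc_in (V := V) setT -> soc_inj f ->
  (forall m n, (m < n)%N -> ~ prime_set p (lam m - lam n)) ->
  exists n, soc_inj (h + lam n *: f).
Proof.
move=> accV finj lamP; apply: contrapT => ninj.
have /choice[w wP] n : exists w, [/\ killed_by p w, ~ tors w & h w = - lam n *: f w].
  apply: contrapT => nw; apply: ninj; exists n => x xp [s ps sx].
  apply: contrapT => xt; apply: nw; exists (s *: x).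
  (* Scaling x by s outside p turns the relation up to torsion into an exact equation. *)
  split; first exact: killed_byZ.
    by move=> /torsion_divl tx; apply/xt/tx.
  have sx' : s *: (h x + lam n *: f x) = 0 by [].
  apply/eqP; rewrite scaleNr -addr_eq0 -sx' scalerDr linearZ [f _]linearZ /=.
  by rewrite !scalerA [lam n * s]mulrC.
pose A n := lspan (fun i : 'I_n => w i).
have [n|n _ [c _ <-]|//|n An] := accV A; first exact: lspanP.
  exists (fun i => if insub (val i) is Some j then c j else 0) => //.
  rewrite big_ord_recr /= insubF ?ltnn // scale0r addr0.
  by apply: eq_bigr => i _; rewrite valK.
have [c _ cw] := An n.+1 _ (lspan_gen (fun i : 'I_n.+1 => w i) ord_max).
(* The coefficients of the relation [w n - \sum_(i < n) c i *: w i = 0]; the default 1 is the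
   coefficient at index n, and independence would put it in p. *)
pose d i := if insub i is Some j then - c j else 1 : R.
apply: (@prime_proper _ p).
have -> : 1 = d n by rewrite /d insubF ?ltnn.
apply: (@eigen_free f h lam w) (ltnSn n) => //; try by move=> i; case: (wP i).
exists 1; first exact: (mulset1 (prime_compl p)).
rewrite big_ord_recr /= {2}/d insubF ?ltnn // !scale1r.
rewrite -(cw : \sum_(i < n) c i *: w i = w n) -big_split big1 //.
by move=> i _; rewrite /= /d valK scaleNr addNr.
Qed.

(* When R/p is a field, h can be replaced by f outright; otherwise R/p is an
   infinite domain, and the powers of a nonunit give infinitely many multiples
   of a. *)
Lemma soc_inj_step f h a : acc_in (V := V) setT -> soc_inj f -> ~ prime_set p a ->
  exists b c, soc_inj (h + a *: (b *: f + c *: h)).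
Proof.
move=> accV finj pa.
have [pmax|/existsNP[b /not_implyP[pb bmax]]] :=
    pselect (forall b, ~ prime_set p b -> exists c, prime_set p (1 - b * c)).
  (* With c inverse to a modulo p, the map h + a (c f - c h) agrees with f on everything that p
     kills. *)
  have [c pac] := pmax a pa; exists c, (- c) => x px.
  have -> : (h + a *: (c *: f + - c *: h)) x = f x.
    have hf (g : linHom V M) : (a * c) *: g x = g x.
      apply/eqP; rewrite -subr_eq0 -opprB oppr_eq0 -{1}[g x]scale1r -scalerBl.
      by rewrite -linearZ px ?linear0.
    transitivity (h x + a *: (c *: f x + - c *: h x)) => //.
    by rewrite scalerDr !scalerA hf mulrN scaleNr hf addrCA subrr addr0.
  exact: finj.
(* Two values a b^m and a b^n with m < n differ by a b^m (1 - b b^(n-m-1)), which is outside p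
   because b has no inverse modulo p. *)
have [|n hn] := @soc_inj_pencil f h (fun n => a * b ^+ n) accV finj.
  move=> m n ltmn.
  have -> : a * b ^+ m - a * b ^+ n = a * (b ^+ m * (1 - b * b ^+ (n - m.+1))).
    by rewrite -exprS -subSn // subSS mulrA mulrBr mulr1 -mulrA -exprD subnKC // ltnW.
  case/prime_or => // /prime_or[|pm]; last by apply: bmax; eexists; apply: pm.
  elim: m {ltmn} => [|m IH]; first by rewrite expr0; apply: prime_proper.
  by rewrite exprS => /prime_or[].
by exists (b ^+ n), 0; rewrite scale0r addr0 scalerA.
Qed.

End Pencil.

(** * Injective capacity and rows of maps *)

Lemma inj_capacity_row (R : comPzRingType) (N M : lmodType R)
    (F : set (linHom N M)) n :
  (0 < n)%N -> (n%:Z%:E <= inj_capacity F)%E ->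
  exists2 m, (n <= m)%N &
    exists2 f : 'I_m -> linHom N M, forall j, F (f j) & injective (row_hom f).
Proof.
rewrite /inj_capacity; set T := [set t%:Z%:E | t in _] => n_gt0 leT.
(* Both defaults in the definition of [supremum] are 0 here, so a positive n rules them out. *)
have n0 : ~ (n%:Z%:E <= (0 : \bar int))%E by rewrite lee_fin lez_nat leqNgt n_gt0.
apply: contrapT => nm; move: leT; rewrite /supremum.
case: ifP => // /negbT/set0P _; case: xgetP => // y -> [_ yP] ley.
(* If no row of length at least n is injective, n - 1 is an upper bound of the lengths, hence of
   their supremum. *)
have : (n%:Z%:E <= n.-1%:Z%:E :> \bar int)%E.
  apply: le_trans ley _; apply: yP => _ [m [_ [[f [Ff ->]] finj]] <-].
  rewrite lee_fin lez_nat -ltnS prednK // ltnNge; apply/negP => lenm.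
  by apply: nm; exists m => //; exists f.
by rewrite lee_fin lez_nat -ltnS prednK // ltnn.
Qed.

Section Rows.
Variables (R : comPzRingType) (N M : lmodType R).
Implicit Types (S : mulset R) (p q : prime_ideal R) (h : nat -> linHom N M).

(** Indexing h by all naturals lets the rows of the various lengths t(p) be initial segments of one
    sequence. *)
Definition row n h : linHom {ffun 'I_n -> N} M := row_hom (fun j : 'I_n => h j).

Lemma row_pencil n f h a : row n (fun j => h j + a *: f j) = row n h + a *: row n f.
Proof.
apply: linHom_eqP => x /=; rewrite /row_fun scaler_sumr -big_split.
exact: eq_bigr.
Qed.

Definition ffun_extend m n (x : {ffun 'I_m -> N}) : {ffun 'I_n -> N} :=
  [ffun i : 'I_n => oapp x 0 (insub (val i))].

Lemma row_extend m n h (x : {ffun 'I_m -> N}) :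
  (m <= n)%N -> row n h (ffun_extend n x) = row m h x.
Proof.
move=> lemn /=; rewrite /row_fun.
pose G i := h i (oapp x 0 (insub i)).
rewrite [RHS](_ : _ = \sum_(i < m) G i); last first.
  by apply: eq_bigr => i _; rewrite /G valK.
rewrite (big_ord_widen _ G lemn) [RHS]big_mkcond /=.
apply: eq_bigr => i _; rewrite ffunE; case: ifPn => // nim.
by rewrite insubF ?linear0 //; apply: negbTE.
Qed.

(** Padding with zeros embeds the shorter power in the longer one, preserving both the value of the
    row and being killed by p. *)
Lemma soc_inj_row_le p m n h : (m <= n)%N -> soc_inj p (row n h) -> soc_inj p (row m h).
Proof.
move=> lemn hinj x xp; rewrite -(row_extend h x lemn) => /hinj tx.
have /torsion_ffun ext : torsion (prime_compl p) (ffun_extend n x).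
  apply: tx => a pa; apply/ffunP => i; rewrite !ffunE.
  case: insubP => [j _ _|_]; last exact: scaler0.
  by move/ffunP/(_ j): (xp a pa); rewrite !ffunE.
apply/torsion_ffun => j; have := ext (widen_ord lemn j).
by rewrite ffunE /= valK.
Qed.

(** Since a g(x) = g(a x), the added term vanishes on whatever p kills. This is how a correction for
    one prime spares the earlier ones. *)
Lemma soc_inj_add_killed (V : lmodType R) p (f g : linHom V M) a :
  prime_set p a -> soc_inj p f -> soc_inj p (f + a *: g).
Proof.
move=> pa finj x xp; have -> : (f + a *: g) x = f x; last exact: finj.
by transitivity (f x + a *: g x); rewrite // -linearZ xp // linear0 addr0.
Qed.

Lemma soc_inj_of_capacity p (F : set (linHom N M)) n : submodule F -> (0 < n)%N ->
  (n%:Z%:E <= inj_capacity (loc_hom (prime_compl p) F))%E ->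
  exists2 f, forall j, F (f j) & soc_inj p (row n f).
Proof.
move=> sF n_gt0 cap; have [m lenm [g gF ginj]] := inj_capacity_row n_gt0 cap.
have /choice[f0 /choice[s fs]] := gF.
pose f i := if insub i is Some j then f0 j else 0.
exists f => [i|]; rewrite /f.
  by case: insubP => [j _ _|_]; [case: (fs j) | apply: submodule0].
apply: soc_inj_row_le lenm _ => x _ [w pw wx]; apply/torsion_ffun => j.
(* The entries of g are the fractions [f0 j / s j]; scaling [x j] by [s j] cancels these
   denominators, so g sends z to the image of [row m f x], which is zero. *)
pose z := [ffun j => lfrac (prime_compl p) (den (s j) *: x j) (denom1 _)].
have /ffunP/(_ j) : z = 0.
  apply: ginj; rewrite linear0 /= /row_fun.
  have -> : \sum_j g j (z j) = \sum_j lfrac _ (f0 j (x j)) (denom1 _).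
    apply: eq_bigr => i _; have [_ ->] := fs i; rewrite ffunE.
    transitivity (rfrac (prime_compl p) 1 (s i) *: 
       loc_map (prime_compl p) (f0 i) (lfrac _ (den (s i) *: x i) (denom1 _))) => //.
    rewrite loc_mapE lfracZ linearZ /=; apply: lfrac_eq => /=.
    by rewrite !scale1r mulr1.
  have <- : lfrac (prime_compl p) (row m f x) (denom1 _) =
      \sum_j lfrac _ (f0 j (x j)) (denom1 _).
    have fracD (y y' : M) : lfrac (prime_compl p) (y + y') (denom1 _) =
        lfrac _ y (denom1 _) + lfrac _ y' (denom1 _).
      by rewrite lfracD; apply: lfrac_eq; rewrite /= !scale1r mulr1 scale1r.
    rewrite /= /row_fun (big_morph (fun y => lfrac _ y (denom1 _)) fracD (erefl _)).
    by apply: eq_bigr => i _; rewrite /f valK.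
  by apply/lfrac_eq0; exists w.
rewrite !ffunE => /lfrac_eq0; apply: torsion_divl; exact: denomP.
Qed.

End Rows.

(** * One sequence of maps for finitely many primes *)

Section Combine.
Variables (R : comPzRingType).
Implicit Types (p q : prime_ideal R) (l : seq (prime_ideal R)).

(** The product of one element of each q outside p works, p being prime. *)
Lemma prime_avoid l p :
  (forall q, q \in l -> ~ (prime_set q `<=` prime_set p)) ->
  exists2 a, ~ prime_set p a & forall q, q \in l -> prime_set q a.
Proof.
elim: l => [|q l IH] lp; first by exists 1 => //; apply: prime_proper.
have [r rl|a pa la] := IH; first by apply: lp; rewrite in_cons rl orbT.
have /existsNP[b /not_implyP[qb pb]] := lp q (mem_head _ _).
exists (b * a) => [/prime_or[]//|r]; rewrite in_cons => /predU1P[->|/la ra].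
  exact: prime_idealMr.
exact: prime_idealMl.
Qed.

Lemma minimal_prime q0 l : exists2 p, p \in q0 :: l &
  forall q, q \in q0 :: l -> prime_set q `<=` prime_set p -> q = p.
Proof.
elim: l q0 => [|q1 l IH] q0.
  by exists q0; [apply: mem_head | move=> q; rewrite inE => /eqP].
have [p pl pmin] := IH q1.
have [q0p|nq0p] := pselect (prime_set q0 `<=` prime_set p).
  exists q0 => [|q]; first exact: mem_head.
  rewrite in_cons => /predU1P[//|ql] qq0.
  have qp := pmin q ql (subset_trans qq0 q0p); rewrite qp in qq0 *.
  by apply: prime_ideal_eq => a; split=> [/qq0|/q0p].
exists p => [|q]; first by rewrite in_cons pl orbT.
by rewrite in_cons => /predU1P[-> //|]; apply: pmin.
Qed.

Variables (N M : lmodType R) (F : set (linHom N M)) (t : prime_ideal R -> nat).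

(* Primes are added in such an order that a later prime never contains an
   earlier one; the correction for a new prime p is then multiplied by an
   element outside p that lies in all previous primes, where it changes
   nothing on socles. *)
Lemma common_row l : submodule F -> acc_in (V := N) setT ->
  (forall p, p \in l -> exists2 f, forall j, F (f j) & soc_inj p (row (t p) f)) ->
  exists2 h, forall j, F (h j) & forall p, p \in l -> soc_inj p (row (t p) h).
Proof.
move=> sF accN; have [n] := ubnP (size l).
elim: n l => // n IH [|q0 l] ltl lF; first by exists (fun=> 0) => // j; apply: submodule0.
(* A minimal p is handled last, after the induction hypothesis for the rest: no other prime of the
   list lies inside it, so [prime_avoid] applies. *)
have [p pl pmin] := minimal_prime q0 l.
pose l' := [seq q <- q0 :: l | q != p].
have [||h hF hinj] := IH l'.
- apply: leq_trans (_ : size (q0 :: l) <= n)%N; last by rewrite -ltnS.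
  rewrite -(count_predC (predC1 p) (q0 :: l)) size_filter -addn1 leq_add2l -has_count.
  by apply/hasP; exists p; rewrite //= eqxx.
- by move=> q; rewrite mem_filter => /andP[_]; apply: lF.
have [|a pa la] := @prime_avoid l' p.
  move=> q; rewrite mem_filter => /andP[/eqP qp ql] /(pmin _ ql)/qp[].
have [f fF finj] := lF p pl.
have [b [c bc]] := soc_inj_step (row (t p) h) (acc_ffun accN) finj pa.
exists (fun j => h j + a *: (b *: f j + c *: h j)) => [j|q ql].
  by do ![apply: submoduleD => // | apply: submoduleZ => //].
rewrite (row_pencil _ (fun j => b *: f j + c *: h j)).
have [->|qp] := eqVneq q p.
  have -> : row (t p) (fun j => b *: f j + c *: h j) = b *: row (t p) f + c *: row (t p) h.
    rewrite (row_pencil _ h (fun j => b *: f j)); congr (_ + _).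
    apply: linHom_eqP => x /=; rewrite /row_fun scaler_sumr; exact: eq_bigr.
  exact: bc.
have ql' : q \in l' by rewrite mem_filter qp.
by apply: soc_inj_add_killed; [apply: la | apply: hinj].
Qed.

End Combine.

(** * From socles to injectivity of localized rows, and the bounds u(S) and v *)

Section Kernel.
Variables (R : comPzRingType) (N M : lmodType R) (N_noeth : noetherian N).
Implicit Types (S : mulset R) (t : prime_ideal R -> nat).


Lemma loc_map_row_inj S n (h : nat -> linHom N M) :
  (forall p, Ass N p -> p `&` S = set0 -> soc_inj p (row n h)) ->
  injective (loc_map S (row n h)).
Proof.
move=> hinj; apply: raddf_inj => z; elim/loc_ind: z => x s.
move=> mz; have {mz} : loc_map S (row n h) (lfrac S x s) = 0 := mz.
rewrite loc_mapE => /lfrac_eq0[w Sw wx]; apply/lfrac_eq0; apply: contrapT => tx.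
(* The vector w x is killed by the row itself and is still not S-torsion, so it has a multiple y in
   the kernel whose annihilator is a prime disjoint from S. *)
have [|p [r [prx pS _]]] := exists_prime_annih (acc_ffun (noetherian_acc N_noeth))
    (S := S) (x := w *: x).
  by move/torsion_divl => wtx; apply/tx/wtx.
pose y := r *: (w *: x); have yp : killed_by p y by move=> a; rewrite -prx.
have ty : ~ torsion (prime_compl p) y by case=> a pa ay; apply: pa; rewrite -prx.
apply: (ty); apply: hinj => //.
  (* Some coordinate of y survives localization at p and is killed by p, which makes p an associated
     prime of N and not merely of its power. *)
  apply: contrapT => npN; apply/ty/torsion_ffun => i; apply: contrapT => tyi.
  apply: npN; apply: killed_by_Ass tyi => a pa.
  by move/ffunP/(_ i): (yp a pa); rewrite !ffunE.
exists 1; first exact: (mulset1 (prime_compl p)).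
have -> : row n h y = r *: (w *: row n h x) by rewrite /y linearZ linearZ.
by rewrite wx !scaler0.
Qed.

(** This makes the minimum u(S) exist. As N is finitely generated, if all its elements were
    S-torsion then a single element of S would annihilate N; a non-torsion element yields the
    prime. *)
Lemma exists_Ass_disjoint S : S `&` annihilator N = set0 ->
  exists p, Ass N p /\ p `&` S = set0.
Proof.
move=> SN; have accN := noetherian_acc N_noeth.
have [x tx] : exists x : N, ~ torsion S x.
  apply/existsNP => tN; have [|n [g gE]] := @N_noeth setT; first by apply/submoduleE.
  have [w Sw wg] := common_torsion (fun i => tN (g i)).
  have : (S `&` annihilator N) w; last by rewrite SN.
  split=> // x; have : setT x by []; rewrite gE => -[c _ <-].
  rewrite scaler_sumr big1 // => i _.
  by rewrite scalerA mulrC -scalerA wg scaler0.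
have [p [r [prx pS _]]] := exists_prime_annih accN tx; exists p; split=> //.
apply: (@killed_by_Ass _ _ _ (r *: x)) => [a|[a pa ax]]; first by rewrite -prx.
by apply: pa; rewrite -prx.
Qed.

Lemma ass_min_spec t S : S `&` annihilator N = set0 ->
  (exists2 p, Ass N p & ass_min N t S = t p) /\
  forall p, Ass N p -> p `&` S = set0 -> (ass_min N t S <= t p)%N.
Proof.
move=> /exists_Ass_disjoint[p0 p0P].
have [|[p [pN _] tpE] lb] := @nat_minP [set t p | p in [set p | Ass N p /\ p `&` S = set0]].
  by exists (t p0), p0.
by split=> [|q qN qS]; [exists p | rewrite -leEnat; apply: lb; exists q].
Qed.

Lemma ass_max_ge t p : Ass N p -> (t p <= ass_max N t)%N.
Proof.
move=> pN; have [l lP] := finite_Ass N_noeth.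
have [||_ ub] := @nat_maxP [set t p | p in @Ass R N] (\max_(q <- l) t q).
- by exists (t p), p.
- by move=> _ [q /lP ql <-]; rewrite leEnat; apply: leq_bigmax_seq.
by rewrite -leEnat; apply: ub; exists p.
Qed.

End Kernel.

Theorem theorem4p1 (R : comPzRingType) (M N : lmodType R)
    (N_neq0 : exists x : N, x != 0) (N_noeth : noetherian N)
    (F : set (linHom N M)) (F_submod : submodule F)
    (t : prime_ideal R -> nat)
    (t_gt0 : forall p, Ass N p -> (0 < t p)%N)
    (t_le_inj : forall p, Ass N p ->
       ((t p)%:Z%:E <= inj_capacity (loc_hom (prime_compl p) F))%E) :
  let u := ass_min N t in
  let v := ass_max N t in
  exists h : 'I_v -> linHom N M,
    [/\ forall i, F (h i),
        forall S : mulset R, S `&` annihilator N = set0 ->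
          exists le_uv : (u S <= v)%N,
            injective
              (loc_map S (row_hom (fun j : 'I_(u S) => h (widen_ord le_uv j))))
      & exists le_uv : (u (mulset_one R) <= v)%N,
          injective
            (row_hom (fun j : 'I_(u (mulset_one R)) => h (widen_ord le_uv j)))].
Proof.
move=> u v.
have [l lP] := finite_Ass N_noeth.
have [h hF hinj] : exists2 h : nat -> linHom N M, forall j, F (h j) &
    forall p, Ass N p -> soc_inj p (row (t p) h).
  (* The list l may contain further primes, while the assumptions on t concern associated ones only;
     hence the filter. *)
  have [p|h hF hinj] := @common_row _ N M F t [seq p <- l | `[< Ass N p >]] F_submod
      (noetherian_acc N_noeth).
    rewrite mem_filter => /andP[/asboolP pN _].
    exact: soc_inj_of_capacity (t_gt0 p pN) (t_le_inj p pN).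
  exists h => // p pN; apply: hinj; rewrite mem_filter lP // andbT.
  exact/asboolP.
have Sinj (S : mulset R) : S `&` annihilator N = set0 ->
    exists le_uv : (u S <= v)%N, injective (loc_map S (row (u S) h)).
  move=> /(ass_min_spec N_noeth t)[[p pN uE] umin].
  have le_uv : (u S <= v)%N by rewrite [u S]uE; apply: ass_max_ge.
  exists le_uv; apply: loc_map_row_inj => // q qN qS.
  by apply: soc_inj_row_le (hinj q qN); apply: umin.
exists (fun i => h i); split=> //.
have [|le_uv inj1] := Sinj (mulset_one R).
  (* A nonzero element of N is not killed by 1, so {1} is an admissible S. *)
  have [x /eqP x0] := N_neq0; apply/seteqP; split=> // _ [/= -> /(_ x)].
  by rewrite scale1r.
exists le_uv => x y xy.
(* All denominators over {1} equal 1, so equal fractions have equal numerators. *)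
have /lfrac_eqP[[w w1] /=] : lfrac (mulset_one R) x (denom1 _) = lfrac _ y (denom1 _).
  by apply: inj1; rewrite !loc_mapE; congr (lfrac _ _ _).
by rewrite [w]w1 mulr1 !scale1r.
Qed.
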